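(* Let $n\ge 3$, let $C_n$ be the cycle on $n$ vertices, and let $G$ be a blow-up $B(C_n)$ of $C_n$ with an even number of vertices, equipped with a weight function $w:V(G)\to\mathbb{R}_{\ge 0}$. Then Alice wins the graph grabbing game on $G$; that is, Alice, who moves first, has a strategy that guarantees her at least half of the total weight $\sum_{v\in V(G)}w(v)$.
   Context: All graphs are finite and simple. Graph grabbing game: it is played on a connected graph $G$ with non-negative vertex weights $w:V(G)\to\mathbb{R}_{\ge 0}$ by two players, Alice and Bob, who move alternately, Alice first. In each move the player claims a vertex $v$ of the remaining graph that is not a cut vertex of it (i.e. deleting $v$ leaves a connected graph; the empty graph counts as connected, so the last vertex may be claimed), collects $w(v)$, and $v$ is deleted. The game ends when all vertices have been claimed. Each player wants to maximize the total weight of the vertices he or she claimed. Alice wins the game on $G$ if, under optimal play, she gains at least half of the total weight. Blow-up: for a graph $F$ with vertices $v_1,\dots,v_k$ and pairwise disjoint non-empty finite sets $V_1,\dots,V_k$, the blow-up $B(F)$ is the graph with vertex set $V_1\cup\dots\cup V_k$ in which $x\in V_i$ and $y\in V_j$ are adjacent if and only if $v_i$ and $v_j$ are adjacent in $F$ (in particular each $V_i$ is an independent set). A blow-up of $F$ is any graph obtained in this way. *)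

(* Defs.v *)
From HB Require Import structures.
From mathcomp Require Import all_boot all_order all_algebra.
From mathcomp Require Import reals.

Set Implicit Arguments.
Unset Strict Implicit.
Unset Printing Implicit Defensive.

Import Order.TTheory GRing.Theory Num.Theory.

Record sgraph := SGraph {
  vertex :> finType;
  adj : rel vertex;
  adj_sym : symmetric adj;
  adj_irr : irreflexive adj
}.

Section Cycle.
Variable n : nat.

(* [ordS i] is i + 1 modulo n.  The conjunct [i != j] only matters for
   n = 1; for n >= 3 this is the usual cycle. *)
Definition cycle_adj : rel 'I_n :=
  [rel i j | (i != j) && ((j == ordS i) || (i == ordS j))].

Lemma cycle_adj_sym : symmetric cycle_adj.
Proof. by move=> i j; rewrite /cycle_adj /= eq_sym orbC. Qed.

Lemma cycle_adj_irr : irreflexive cycle_adj.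
Proof. by move=> i; rewrite /cycle_adj /= eqxx. Qed.

Definition cycle_graph : sgraph := SGraph cycle_adj_sym cycle_adj_irr.

End Cycle.

Definition is_blowup (F G : sgraph) : Prop :=
  exists V : F -> {set G},
    [/\ forall i, V i != set0,
        forall i j, i != j -> [disjoint V i & V j],
        \bigcup_i V i = [set: G]
      & forall i j x y, x \in V i -> y \in V j -> adj x y = adj i j].

Section Game.
Variable G : sgraph.

(* Connectedness of the subgraph induced by S; it holds for S = set0. *)
Definition connected_on (S : {set G}) : bool :=
  [forall x in S, forall y in S,
     connect [rel u v | [&& u \in S, v \in S & adj u v]] x y].

Definition claimable (S : {set G}) (v : G) : bool :=
  (v \in S) && connected_on (S :\ v).

(* Plays, partial or complete, are the sequences of vertices claimed so far,
   in chronological order, by the two players together. *)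
Fixpoint legal_from (S : {set G}) (p : seq G) : bool :=
  if p is v :: p' then claimable S v && legal_from (S :\ v) p' else true.

Definition legal (p : seq G) : bool := legal_from [set: G] p.

Definition complete (p : seq G) : bool := legal p && (size p == #|G|).

(* Alice moves first: she claims the entries of even index. *)
Fixpoint alice_moves (p : seq G) : seq G :=
  match p with
  | [::] => [::]
  | [:: a] => [:: a]
  | a :: _ :: p' => a :: alice_moves p'
  end.

(* A strategy maps the history of the game to Alice's next move; its values
   only matter at the unfinished histories where it is her turn. *)
Definition alice_strategy (sigma : seq G -> G) : Prop :=
  forall p, legal p -> size p < #|G| -> ~~ odd (size p) ->
    legal (rcons p (sigma p)).

Definition follows (sigma : seq G -> G) (p : seq G) : Prop :=
  forall q v, prefix (rcons q v) p -> ~~ odd (size q) -> v = sigma q.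

Local Open Scope ring_scope.

Definition alice_wins (R : realType) (w : G -> R) : Prop :=
  exists2 sigma, alice_strategy sigma &
    forall p, complete p -> follows sigma p ->
      (\sum_(v : G) w v) / 2 <= \sum_(v <- alice_moves p) w v.

End Game.

(* Main.v *)
Require Import Defs.
From mathcomp Require Import all_boot all_order all_algebra.
From mathcomp Require Import reals.
From mathcomp Require Import zify lra.

Set Implicit Arguments.
Unset Strict Implicit.
Unset Printing Implicit Defensive.

Import Order.TTheory GRing.Theory Num.Theory.

(** Write V for the value of a position: the total collected by the player to
    move minus the total collected by the opponent, from now on and under
    optimal play ([value]).  Alice wins as soon as V >= 0 at the start, by
    always making an optimal move; so the point is that V >= 0 whenever the
    number of vertices is even.

    As long as no part of the blow-up of the cycle is exhausted, every vertex
    may be claimed.  The player to move then claims a heaviest vertex, the reply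
    is no heavier, and an even position remains.  Once a part is exhausted, what
    is left is a blow-up of a path, with parts numbered from left to right, and
    it must be shown that V >= 0 for even blow-ups of paths
    ([linked_value_ge0]).

    This is done by comparing the real game on a blow-up S of a path, where S
    has to stay connected ([linked]), with rooted games ([anchored r]) in which
    the vertices of part r may be claimed at any time, while every vertex to the
    left of it has to stay connected to a vertex of part r - 1.  With V for
    the real game and V_r for the rooted one, the two facts proved by a joint
    induction ([free_vs_anchored]) are:

    (1) V(S) >= V_r(S) if |S| is even, and V(S) <= V_r(S) if |S| is odd: the
        freedom of the real game favours the player who does not move last;

    (2) V(S) + V_(k+1)(S) >= 0 if |S| is even and k is the last part of S.

    Together they give 2 V(S) >= 0 for even S.

    For (1), follow an optimal move in the game that the inequality bounds from
    above.  The other game forbids that move in two cases only.  In the real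
    game, one may exhaust the last part k, whereas in the rooted game a lone
    vertex of part k is collected at the very end; the difference between the
    two is exactly (2) for what remains.  In the rooted game, one may claim the
    centre of a star, which disconnects its leaves in the real game; there,
    claiming heaviest leaves until an edge remains is good enough
    ([free_value_step]).

    For (2), let a and z be a heaviest and a lightest vertex of the last part k.
    In the rooted game z may be assumed to be collected at the very end, by the
    second player: V_(k+1)(S) = V_k(S - z) - w(z) ([locked_value]).  In the real
    game the first player may claim a, so that V(S) >= w(a) - V_k(S - a) by (1).
    The positions S - a and S - z differ by a substitution of one vertex of
    part k for another, which changes V_k by at most w(a) - w(z)
    ([anchored_value_swap]).  Hence the sum is nonnegative. *)

(** * Optimal play in vertex-claiming games *)

Section Value.
Variables (R : realDomainType) (T : finType) (w : T -> R).
Local Open Scope ring_scope.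
Implicit Types (ok : pred {set T}) (S : {set T}).

Definition options ok S := [set v in S | ok (S :\ v)].

(** The first argument of type [nat] is a recursion bound, to be instantiated
    with the number of vertices left.  The value 0 for a stuck position is
    arbitrary: a [playable] game never gets stuck before all vertices are
    claimed. *)
Fixpoint value_rec ok n S : R :=
  if n is m.+1 then
    let gain v := w v - value_rec ok m (S :\ v) in
    if [pick v in options ok S] is Some v0
    then gain [arg max_(v > v0 in options ok S) gain v]%O else 0
  else 0.

Definition value ok S := value_rec ok #|S| S.

Definition playable ok :=
  forall S, ok S -> S != set0 -> exists2 v, v \in S & ok (S :\ v).

Lemma value0 ok : value ok set0 = 0.
Proof. by rewrite /value cards0. Qed.

(** With [value0], this recursive characterization is all that is used of [value]. *)
Lemma valueP ok S v0 : v0 \in S -> ok (S :\ v0) ->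
  exists v, [/\ v \in S, ok (S :\ v), value ok S = w v - value ok (S :\ v)
    & forall u, u \in S -> ok (S :\ u) -> w u - value ok (S :\ u) <= value ok S].
Proof.
move=> v0S okv0.
have cS v : v \in S -> value_rec ok #|S|.-1 (S :\ v) = value ok (S :\ v).
  by move=> vS; rewrite /value (cardsD1 v S) vS.
rewrite [value ok S]/value; case Ec: #|S| cS => [|n] /= cS.
  by rewrite (cards0_eq Ec) inE in v0S.
case: pickP => [v1 v1o|/(_ v0)]; last by rewrite inE v0S okv0.
case: arg_maxP => // v; rewrite inE => /andP[vS okv] vmax.
exists v; split=> //; first by rewrite cS.
by move=> u uS oku; rewrite -cS //; apply: vmax; rewrite inE uS.
Qed.

Lemma value_ge ok S v :
  v \in S -> ok (S :\ v) -> w v - value ok (S :\ v) <= value ok S.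
Proof. by move=> vS okv; have [u [_ _ _]] := valueP vS okv; apply. Qed.

Lemma value_attained ok S : playable ok -> ok S -> S != set0 ->
  exists v, [/\ v \in S, ok (S :\ v) & value ok S = w v - value ok (S :\ v)].
Proof.
move=> pl okS S0; have [v vS okv] := pl _ okS S0.
by have [u [? ? ? _]] := valueP vS okv; exists u.
Qed.

Lemma eq_value ok ok' S : playable ok -> ok S ->
  (forall S', S' \subset S -> ok S' = ok' S') -> value ok S = value ok' S.
Proof.
move=> pl; have [n] := ubnP #|S|; elim: n S => // n IHn S leSn okS eqok.
have [->|S0] := eqVneq S set0; first by rewrite !value0.
have sub v : S :\ v \subset S by exact: subD1set.
have IH v : v \in S -> ok (S :\ v) -> value ok (S :\ v) = value ok' (S :\ v).
  move=> vS okv; apply: IHn => // [|S' sS'].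
    by rewrite (cardsD1 v S) vS in leSn.
  exact/eqok/(subset_trans sS')/sub.
have [v0 v0S okv0] := pl _ okS S0.
have [v [vS okv Ev vmax]] := valueP v0S okv0.
have okv0' : ok' (S :\ v0) by rewrite -eqok.
have [u [uS oku Eu umax]] := valueP v0S okv0'; rewrite -eqok // in oku.
apply/le_anti/andP; split; first by rewrite Ev IH // umax // -eqok.
by rewrite Eu -IH // vmax.
Qed.

(** If [a] and [b] are interchangeable for the rules, a strategy for one position
    is copied in the other, with [b] in the role of [a]; the outcomes differ only
    by who collects what at the single exchanged vertex. *)
Lemma value_swap ok (S : {set T}) a b : playable ok ->
  (forall S', S' \subset S -> ok (a |: S') = ok (b |: S')) ->
  a \notin S -> b \notin S -> ok (a |: S) ->
  value ok (a |: S) <= value ok (b |: S) + `|w a - w b|.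
Proof.
move=> pl; have [n] := ubnP #|S|.
elim: n S a b => // n IHn S a b leSn okab aS bS okaS.
have aS0 : a |: S != set0 by apply/set0Pn; exists a; rewrite setU11.
have [f [faS okf ->]] := value_attained pl okaS aS0.
have wab := ler_norm (w a - w b).
have [fa|fa] := eqVneq f a.
  rewrite fa setU1K // in okf *.
  have := @value_ge ok (b |: S) b (setU11 _ _); rewrite setU1K // => /(_ okf); lra.
have fS : f \in S by move: faS; rewrite in_setU1 (negPf fa).
have fb : f != b by apply: contraNneq bS => <-.
have sSf : S :\ f \subset S by exact: subD1set.
have DU c : f != c -> (c |: S) :\ f = c |: (S :\ f).
  by move=> fc; apply/setP=> x; rewrite !inE; case: eqVneq => // ->; rewrite (negPf fc).
have sub : value ok (b |: (S :\ f)) <= value ok (a |: (S :\ f)) + `|w b - w a|.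
  apply: IHn; rewrite ?inE ?(negPf aS) ?(negPf bS) ?andbF //.
  - by rewrite (cardsD1 f S) fS in leSn.
  - by move=> S' sS'; rewrite okab // (subset_trans sS').
  - by rewrite -okab // -DU.
rewrite distrC in sub.
have := @value_ge ok (b |: S) f; rewrite in_setU1 fS orbT DU // => /(_ isT).
by rewrite -okab // -DU // => /(_ okf); rewrite DU //; lra.
Qed.

End Value.

(** * Blow-ups of paths, seen through the positions of the parts *)

Lemma setD1C (T : finType) (S : {set T}) a b : S :\ a :\ b = S :\ b :\ a.
Proof. by rewrite !setDDl setUC. Qed.

Section Positions.
Variables (T : finType) (p : T -> nat).
Implicit Types (S : {set T}).

Definition occupied S j := [exists u in S, p u == j].

Definition gapless S :=
  [forall u in S, forall v in S, (p u < p v) ==> occupied S (p u).+1].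

Definition spread S :=
  (#|S| <= 1) || [exists u in S, exists v in S, p u != p v].

(** For a set of vertices of a blow-up of a path, where [p] is the position of
    the part of a vertex, this is connectedness: a gap in the positions
    separates, and a single part is an independent set. *)
Definition linked S := gapless S && spread S.

(** The positions allowed by the game rooted at parts [r.-1] and [r], the edges
    between these two parts being deleted and no vertex lying to the right of
    [r]: part [r] is then unconstrained.  For an [S] without vertices in part
    [r], this is connectedness of [S] together with one more vertex placed in
    part [r]. *)
Definition anchored r S :=
  [forall u in S, (p u <= r) && (((p u).+1 < r) ==> occupied S (p u).+1)].

Lemma occupiedP S j : reflect (exists2 u, u \in S & p u = j) (occupied S j).
Proof.
apply: (iffP existsP) => [[u /andP[uS /eqP]]|[u uS <-]]; first by exists u.
by exists u; rewrite uS eqxx.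
Qed.

Lemma gaplessP S : reflect
  (forall u v, u \in S -> v \in S -> p u < p v ->
     exists2 x, x \in S & p x = (p u).+1) (gapless S).
Proof.
apply: (iffP forall_inP) => [gS u v uS vS uv|gS u uS].
  by apply/occupiedP; have /forall_inP/(_ _ vS)/implyP := gS u uS; apply.
by apply/forall_inP=> v vS; apply/implyP=> uv; apply/occupiedP/(gS u v).
Qed.

Lemma spreadP S : reflect
  (forall u v, u \in S -> v \in S -> u != v -> exists2 x, x \in S & p x != p u)
  (spread S).
Proof.
apply: (iffP orP) => [[cS|/exists_inP[x xS /exists_inP[y yS xy]]]|sS].
- by move=> u v uS vS /negP[]; apply/eqP/(card_le1_eqP cS).
- move=> u v uS vS uv; have [Ex|] := eqVneq (p x) (p u); last by exists x.
  by exists y; rewrite // -Ex eq_sym.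
case: (leqP #|S| 1) => [|/card_gt1P[u [v [uS vS uv]]]]; [by left|right].
have [x xS xu] := sS u v uS vS uv.
by apply/exists_inP; exists x => //; apply/exists_inP; exists u.
Qed.

Lemma anchoredP r S : reflect
  (forall u, u \in S -> p u <= r /\
     ((p u).+1 < r -> exists2 x, x \in S & p x = (p u).+1)) (anchored r S).
Proof.
apply: (iffP forall_inP) => aS u uS.
  by have /andP[ur /implyP ao] := aS u uS; split=> // /ao /occupiedP.
have [ur ao] := aS u uS; rewrite ur; by apply/implyP => /ao /occupiedP.
Qed.

Lemma exists_lowest S : S != set0 ->
  exists2 u, u \in S & forall x, x \in S -> p u <= p x.
Proof. by case/set0Pn=> u0 u0S; case: (arg_minnP p u0S) => u; exists u. Qed.

Lemma exists_highest S : S != set0 ->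
  exists2 u, u \in S & forall x, x \in S -> p x <= p u.
Proof. by case/set0Pn=> u0 u0S; case: (arg_maxnP p u0S) => u; exists u. Qed.

Lemma anchored_gapless r S : anchored r S -> gapless S.
Proof.
move/anchoredP=> aS; apply/gaplessP=> u v uS vS uv.
have [_ ao] := aS u uS; have [vr _] := aS v vS.
have [/ao //|ru] := ltnP (p u).+1 r.
by exists v => //; lia.
Qed.

Lemma anchored_playable r : playable (anchored r).
Proof.
move=> S /anchoredP aS /exists_lowest[u uS umin].
exists u => //; apply/anchoredP=> x /setD1P[_ xS].
have [xr ao] := aS x xS; split=> // /ao[y yS Ey].
exists y => //; rewrite !inE yS andbT; have := umin x xS.
by apply: contraTneq => yu; rewrite -yu Ey ltnn.
Qed.

Lemma gapless_lowest S u : gapless S -> (forall x, x \in S -> p u <= p x) ->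
  gapless (S :\ u).
Proof.
move/gaplessP=> gS umin; apply/gaplessP=> x y /setD1P[_ xS] /setD1P[_ yS] xy.
have [z zS Ez] := gS x y xS yS xy; exists z => //.
rewrite !inE zS andbT; have := umin x xS.
by apply: contraTneq => zu; rewrite -zu Ez ltnn.
Qed.

(** The only way in which claiming [f] can disconnect a blow-up of a path without
    opening a gap: the two parts left are [f] alone, and at least two leaves. *)
Definition star S f q := [/\ linked S, f \in S, 1 < #|S :\ f| &
  forall x, x \in S :\ f -> p x = q].

Lemma unlinked_star S f : linked S -> f \in S -> gapless (S :\ f) ->
  ~~ linked (S :\ f) -> exists q, star S f q.
Proof.
move=> lS fS gS; rewrite /linked gS /= negb_or -ltnNge => /andP[cS nS].
have [x xS] : exists x, x \in S :\ f by apply/set0Pn; rewrite -card_gt0; lia.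
exists (p x); split=> // y yS; apply/eqP; apply: contraNT nS => yx.
by apply/exists_inP; exists y => //; apply/exists_inP; exists x.
Qed.

Lemma star_center S f q : star S f q -> q = (p f).+1 \/ p f = q.+1.
Proof.
case=> /andP[/gaplessP gS /spreadP sS] fS /card_gt1P[x [y [xS yS xy]]] Eq.
have xS' := subsetP (subD1set S f) _ xS; have yS' := subsetP (subD1set S f) _ yS.
have [z zS zx] := sS x y xS' yS' xy; rewrite (Eq x) // in zx.
have zf : z = f by apply: contraNeq zx => zf; rewrite Eq // !inE zf.
rewrite {}zf in zx.
case: (ltngtP (p f) q) zx => // [fq|qf] _.
  have [|t tS Et] := gS f x fS xS'; first by rewrite (Eq x).
  left; rewrite -Et (Eq t) // !inE tS andbT.
  by apply: contra_eq_neq Et => ->; rewrite neq_ltn ltnSn.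
have [|t tS Et] := gS x f xS' fS; first by rewrite (Eq x).
rewrite (Eq x) // in Et; right; rewrite -Et; congr p; apply/eqP.
rewrite eq_sym; apply: contraT => tf.
by have := Eq t; rewrite !inE tS tf Et => /(_ isT); lia.
Qed.

Lemma star_linked F f q : F != set0 -> (forall x, x \in F -> p x = q) ->
  q = (p f).+1 \/ p f = q.+1 -> linked (f |: F).
Proof.
move=> /set0Pn[x0 x0F] Eq fq; apply/andP; split.
  apply/gaplessP=> u v; rewrite !in_setU1.
  have D z : (z == f) || (z \in F) -> p z = p f \/ p z = q.
    by case/orP=> [/eqP->|/Eq]; [left|right].
  move=> /D uS /D vS uv.
  have [] : (p u).+1 = p f \/ (p u).+1 = q by lia.
    by exists f; rewrite ?setU11.
  by exists x0; rewrite ?in_setU1 ?x0F ?orbT // Eq.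
apply/spreadP=> u v uS vS uv.
have [uf|uf] := eqVneq (p u) (p f).
  by exists x0; rewrite ?in_setU1 ?x0F ?orbT // Eq // uf; lia.
by exists f; rewrite ?setU11 // eq_sym.
Qed.

Lemma linked1 u : linked [set u].
Proof.
apply/andP; split; last by rewrite /spread cards1.
by apply/gaplessP=> x y /set1P-> /set1P->; rewrite ltnn.
Qed.

(** The leftmost vertex can be claimed unless it is the centre of a star, and then
    any leaf can. *)
Lemma linked_playable : playable linked.
Proof.
move=> S lS S0; have [u uS umin] := exists_lowest S0.
have gS : gapless (S :\ u) by case/andP: lS => gS _; exact: gapless_lowest.
have [lu|nlu] := boolP (linked (S :\ u)); first by exists u.
have [q sq] := unlinked_star lS uS gS nlu.
have qu := star_center sq; have [_ _ cS Eq] := sq.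
have [y [z [yS zS yz]]] := card_gt1P cS.
exists y; first by case/setD1P: yS.
have uy : u != y by case/setD1P: yS => + _; rewrite eq_sym.
rewrite -(@setD1K _ u (S :\ y)); last by rewrite !inE uy.
apply: (@star_linked _ u q) => //.
  by apply/set0Pn; exists z; rewrite setD1C in_setD1 eq_sym yz.
by move=> x; rewrite setD1C => /setD1P[_ /Eq].
Qed.

(** Setting aside one vertex [a] of the last part [k] turns the game rooted beyond
    part [k] into the one where part [k] is unconstrained: while [a] is present,
    the rest of part [k] supports nothing.  The next lemma is the converse. *)
Lemma anchored_lower k S a : anchored k.+1 S -> p a = k ->
  (forall u, u \in S -> p u <= k) -> anchored k (S :\ a).
Proof.
move=> /anchoredP aS Ea Sk; apply/anchoredP=> u /setD1P[ua uS].
split=> [|uk]; first exact: Sk.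
have [|x xS Ex] := (aS u uS).2; first by lia.
exists x => //; rewrite !inE xS andbT.
by apply: contraTneq uk => xa; rewrite -Ea -xa; lia.
Qed.

Lemma anchored_raise k S a : a \in S -> p a = k -> anchored k (S :\ a) ->
  (forall u, u \in S -> p u <= k) -> anchored k.+1 S.
Proof.
move=> aS Ea /anchoredP akS Sk; apply/anchoredP=> u uS.
have uk := Sk u uS; split=> [|uk1]; first by lia.
have [Eu|nEu] := eqVneq (p u).+1 k; first by exists a; rewrite ?Ea.
have uSa : u \in S :\ a.
  by rewrite !inE uS andbT; apply: contraNneq nEu => ua; rewrite ua in uk1; lia.
have [|x /setD1P[_ xS] Ex] := (akS u uSa).2; first by lia.
by exists x.
Qed.

Lemma anchored_top k S : anchored k.+1 S -> (forall u, u \in S -> p u <= k) ->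
  S != set0 -> exists2 a, a \in S & p a = k.
Proof.
move=> /anchoredP aS Sk /exists_highest[a aS' amax]; exists a => //.
have ak := Sk a aS'; case: (ltngtP (p a) k) ak => // ak _.
have [|x xS Ex] := (aS a aS').2; first by lia.
by have := amax x xS; rewrite Ex ltnn.
Qed.

(** A move of the real game that the rooted game forbids removes the last support
    of the vertices to its left; as they remain connected, it exhausts the last
    part. *)
Lemma unanchored_step r S f : linked S -> anchored r S -> f \in S ->
  linked (S :\ f) -> ~~ anchored r (S :\ f) ->
  exists k, [/\ r = k.+2, p f = k.+1, anchored k.+1 (S :\ f)
    & forall u, u \in S :\ f -> p u <= k].
Proof.
move=> /andP[/gaplessP gS _] /anchoredP aS fS /andP[/gaplessP gSf _] naS.
have [x xS [xr nx]] : exists2 x, x \in S :\ f &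
    (p x).+1 < r /\ forall y, y \in S :\ f -> p y <> (p x).+1.
  move: naS; rewrite negb_forall_in => /exists_inP[x xS].
  have [xr _] := aS x (subsetP (subD1set _ _) _ xS).
  rewrite xr negb_imply => /andP[xr1 /occupiedP nx]; exists x => //; split=> //.
  by move=> y yS Ey; case: nx; exists y.
have xS' : x \in S by case/setD1P: xS.
have [y yS Ey] := (aS x xS').2 xr.
have yf : y = f by apply/eqP; apply: contraTT isT => yf; case: (nx y); rewrite ?inE ?yf.
rewrite {y yS}yf in Ey.
have Sx u : u \in S :\ f -> p u <= p x.
  move=> uS; rewrite leqNgt; apply/negP=> xu.
  by have [z zS Ez] := gSf x u xS uS xu; case: (nx z).
exists (p x); split=> //.
- have [fr fo] := aS f fS; have [/fo[y yS Ey']|] := ltnP (p f).+1 r; last by lia.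
  have yf : y != f by apply: contraTneq isT => yf; move: Ey'; rewrite yf; lia.
  by have := Sx y; rewrite !inE yf yS => /(_ isT); lia.
- apply/anchoredP=> u uS; split=> [|ux]; first by have := Sx u uS; lia.
  exact: (gSf u x uS xS).
Qed.

End Positions.

(** * The real game against the rooted games *)

Lemma odd_cardD1 (T : finType) (S : {set T}) v :
  v \in S -> odd #|S :\ v| = ~~ odd #|S|.
Proof. by move=> vS; rewrite (cardsD1 v S) vS /= negbK. Qed.

Lemma ltn_cardD1 (T : finType) (S : {set T}) v : v \in S -> #|S :\ v| < #|S|.
Proof. by move=> vS; rewrite [ltnRHS](cardsD1 v S) vS. Qed.

Lemma exists_max (R : realDomainType) (T : finType) (w : T -> R) (S : {set T}) :
  S != set0 -> exists2 y, y \in S & forall x, x \in S -> (w x <= w y)%R.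
Proof.
case/set0Pn=> x0 x0S; exists [arg max_(x > x0 in S) w x]%O.
  by case: arg_maxP.
by move=> x xS; case: arg_maxP => // y _ /(_ x xS).
Qed.

Lemma exists_min (R : realDomainType) (T : finType) (w : T -> R) (S : {set T}) :
  S != set0 -> exists2 y, y \in S & forall x, x \in S -> (w y <= w x)%R.
Proof.
move=> S0; have [y yS ymin] := exists_max (fun x => - w x)%R S0.
by exists y => // x /ymin; rewrite lerN2.
Qed.

Section PathGame.
Variables (R : realDomainType) (T : finType) (p : T -> nat) (w : T -> R).
Implicit Types (S F : {set T}).
Local Open Scope ring_scope.

Local Notation free_value := (value w (linked p)).
Local Notation anchored_value r := (value w (anchored p r)).

Lemma odd_set0 S : odd #|S| -> S != set0.
Proof. by apply: contraTneq => ->; rewrite cards0. Qed.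

(** The player to move keeps claiming a heaviest leaf.  Each round loses nothing,
    except that the opponent may remove the lightest leaf [x]; in that round
    alone the gain [w y - w x] covers the increase of the minimum, because the
    new lightest leaf weighs at most [w y].  When a single leaf is left, [f] is
    claimed, and the leaf is the opponent's. *)
Lemma star_free_value F f q x : (forall y, y \in F -> p y = q) ->
  (q = (p f).+1 \/ p f = q.+1)%N -> odd #|F| -> x \in F ->
  (forall y, y \in F -> w x <= w y) ->
  w f - w x <= free_value (f |: F).
Proof.
have [n] := ubnP #|F|; elim: n F x => // n IHn F x leFn Fq fq oF xF xmin.
have fF : f \notin F by apply/negP=> /Fq; lia.
have lU F' : F' != set0 -> F' \subset F -> linked p (f |: F').
  by move=> F'0 /subsetP sF; apply: (@star_linked _ _ _ _ q) => // y /sF /Fq.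
have [y yF ymax] := exists_max w (odd_set0 oF).
have [F1|F3] := eqVneq #|F| 1%N.
  have [z Ez] : exists z, F = [set z] by apply/cards1P/eqP.
  move: xF fF {lU IHn}; rewrite {F leFn Fq oF xmin yF ymax F1}Ez.
  move=> /set1P->; rewrite inE => fz.
  have Ef : (f |: [set z]) :\ f = [set z] by rewrite setU1K // inE.
  have := @value_ge _ _ w (linked p) (f |: [set z]) f (setU11 _ _).
  rewrite Ef => /(_ (linked1 p z)).
  have := @value_ge _ _ w (linked p) [set z] z (set11 _).
  have z0 : [set z] != set0 by rewrite -card_gt0 cards1.
  have [u [/set1P-> _ ->]] := value_attained w (@linked_playable _ p) (linked1 p z) z0.
  by rewrite setDv value0 subr0.
have DU F' z : z \in F -> (f |: F') :\ z = f |: (F' :\ z).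
  move=> zF; apply/setP=> t; rewrite !inE; case: eqVneq => // ->.
  by rewrite (_ : z == f = false) //; apply: contraNF fF => /eqP <-.
have cF := ltn_cardD1 yF; have oFy := odd_cardD1 yF; rewrite oF /= in oFy.
have F0 : F :\ y != set0.
  by apply: contra_neq F3 => F0; rewrite (cardsD1 y F) yF F0 cards0.
have lfy : linked p ((f |: F) :\ y) by rewrite DU // lU // subD1set.
have := @value_ge _ _ w (linked p) (f |: F) y; rewrite in_setU1 yF orbT.
move=> /(_ isT lfy).
have [] := value_attained w (@linked_playable _ p) lfy.
  by apply/set0Pn; exists f; rewrite DU // setU11.
move=> z [zS lz ->].
have zF : z \in F :\ y.
  move: zS; rewrite DU // in_setU1 => /orP[/eqP zf|//].
  have fFy : f \notin F :\ y by rewrite inE (negPf fF) andbF.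
  move: lz; rewrite zf DU // setU1K // => /andP[_ /spreadP sp].
  have /card_gt1P[s [t [sF tF st]]] : (1 < #|F :\ y|)%N.
    by move: F0; rewrite -card_gt0; case: #|_| oFy => [|[|]].
  have [v /setD1P[_ vF]] := sp s t sF tF st.
  by rewrite (Fq v vF) (Fq s) ?eqxx //; case/setD1P: sF.
have zF' : z \in F by case/setD1P: zF.
rewrite !DU //.
have oF2 : odd #|F :\ y :\ z| by rewrite odd_cardD1 // oFy.
have [x' x'F x'min] := exists_min w (odd_set0 oF2).
have sub t : t \in F :\ y :\ z -> t \in F by rewrite !inE => /and3P[].
have := IHn (F :\ y :\ z) x' _ _ fq oF2 x'F x'min.
move=> /(_ _ (fun t tF => Fq t (sub t tF))).
have cF2 := ltn_cardD1 zF; move=> /(_ ltac:(lia)).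
have := ymax x' (sub _ x'F); have := ymax z zF'.
have [->|xz] := eqVneq z x; first by lra.
have [Exy|xy] := eqVneq y x; last first.
  by have := x'min x; rewrite !inE xF andbT eq_sym xz eq_sym xy => /(_ isT); lra.
by have := xmin x' (sub _ x'F); have := xmin z zF'; rewrite -Exy; lra.
Qed.

Lemma flat_anchored r F F' q : (forall y, y \in F -> p y = q) ->
  anchored p r F -> F' \subset F -> anchored p r F'.
Proof.
move=> Fq /anchoredP aF /subsetP sF; apply/anchoredP=> u /sF uF.
have [ur ao] := aF u uF; split=> // /ao[v vF].
by rewrite (Fq v vF) (Fq u uF); lia.
Qed.

(** When all vertices are free and their number is odd, claiming heaviest vertices
    never loses a round and leaves a last vertex to the same player. *)
Lemma flat_anchored_value r F q x : (forall y, y \in F -> p y = q) ->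
  anchored p r F -> odd #|F| -> x \in F -> (forall y, y \in F -> w x <= w y) ->
  w x <= anchored_value r F.
Proof.
have [n] := ubnP #|F|; elim: n F x => // n IHn F x leFn Fq aF oF xF xmin.
have sa := flat_anchored Fq aF.
have [y yF ymax] := exists_max w (odd_set0 oF).
have aFy := sa _ (subD1set F y).
have := value_ge w yF aFy.
have cF := ltn_cardD1 yF; have oFy := odd_cardD1 yF; rewrite oF /= in oFy.
have [->|F0] := eqVneq (F :\ y) set0.
  by rewrite value0; have := xmin y yF; lra.
have [z [zF az ->]] := value_attained w (@anchored_playable _ p r) aFy F0.
have oF2 : odd #|F :\ y :\ z| by rewrite odd_cardD1 // oFy.
have [x' x'F x'min] := exists_min w (odd_set0 oF2).
have sub t : t \in F :\ y :\ z -> t \in F by rewrite !inE => /and3P[].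
have cF2 := ltn_cardD1 zF.
have := IHn (F :\ y :\ z) x' _ (fun t tF => Fq t (sub t tF)) az oF2 x'F x'min.
move=> /(_ ltac:(lia)); have := xmin x' (sub _ x'F).
have := ymax z; case/setD1P: zF => _ zF /(_ zF); lra.
Qed.

Lemma anchored_swap r S a b : p a = p b ->
  anchored p r (a |: S) = anchored p r (b |: S).
Proof.
suff sub c d : p c = p d -> anchored p r (c |: S) -> anchored p r (d |: S).
  by move=> pab; apply/idP/idP; apply: sub.
move=> pcd /anchoredP aS; apply/anchoredP.
have H u : u \in c |: S -> (p u <= r)%N /\ (((p u).+1 < r)%N ->
    exists2 x, x \in d |: S & p x = (p u).+1).
  move=> /aS[ur ao]; split=> // /ao[x]; case/setU1P=> [-> <-|xS <-].
    by exists d; rewrite ?setU11.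
  by exists x; rewrite // setU1r.
move=> u /setU1P[->|uS]; last by apply: H; rewrite setU1r.
by have := H c (setU11 _ _); rewrite pcd.
Qed.

Lemma anchored_value_swap r S a b : a \in S -> b \in S -> p a = p b ->
  anchored p r (S :\ a) ->
  anchored_value r (S :\ a) <= anchored_value r (S :\ b) + `|w a - w b|.
Proof.
move=> aS bS pab; have [->|ab] := eqVneq a b; first by rewrite subrr normr0 addr0.
have Ea : S :\ a = b |: (S :\ a :\ b) by rewrite setD1K // !inE eq_sym ab.
have Eb : S :\ b = a |: (S :\ a :\ b) by rewrite setD1C setD1K // !inE ab.
rewrite {}Ea {}Eb distrC => aSa; apply: value_swap => //.
- exact: anchored_playable.
- by move=> S' _; apply: anchored_swap.
- by rewrite !inE eqxx.
- by rewrite !inE eqxx andbF.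
Qed.

(** In the game rooted beyond the last part [k], some vertex of part [k] has to stay
    until everything else is gone.  It may as well be the lightest one, [z]:
    claiming [z] while another vertex [t] of part [k] is there is no better than
    claiming [t], by the swap lemma.  The parity of [S] says who collects [z]. *)
Lemma locked_value k S z : anchored p k.+1 S ->
  (forall u, u \in S -> p u <= k)%N -> z \in S -> p z = k ->
  (forall y, y \in S -> p y = k -> w z <= w y) ->
  anchored_value k.+1 S
    = anchored_value k (S :\ z) + (if odd #|S| then w z else - w z).
Proof.
have [n] := ubnP #|S|; elim: n S z => // n IHn S z leSn aS Sk zS pz zmin.
have aSz : anchored p k (S :\ z) by exact: anchored_lower.
have S0 : S != set0 by apply/set0Pn; exists z.
have step f : f \in S -> f != z -> anchored p k.+1 (S :\ f) ->
    anchored_value k.+1 (S :\ f) =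
    anchored_value k (S :\ z :\ f) - (if odd #|S| then w z else - w z).
  move=> fS fz af; rewrite setD1C (IHn _ z) //.
  - by rewrite odd_cardD1 //; case: odd; rewrite ?opprK.
  - by have := ltn_cardD1 fS; lia.
  - by move=> u /setD1P[_ /Sk].
  - by rewrite !inE eq_sym fz.
  - by move=> y /setD1P[_ /zmin].
apply/le_anti/andP; split.
  have hi f : f \in S -> f != z -> anchored p k.+1 (S :\ f) ->
      w f - anchored_value k.+1 (S :\ f) <=
      anchored_value k (S :\ z) + (if odd #|S| then w z else - w z).
    move=> fS fz af; rewrite step //.
    have fSz : f \in S :\ z by rewrite !inE fz.
    have af' : anchored p k (S :\ z :\ f).
      rewrite setD1C; apply: anchored_lower => // u; first by move/setD1P=> [_ /Sk].
    by have := value_ge w fSz af'; lra.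
  have [f [fS af ->]] := value_attained w (@anchored_playable _ p k.+1) aS S0.
  have [fz|fz] := eqVneq f z; last exact: hi.
  rewrite fz in af * => {f fS fz}.
  have [Sz0|Sz0] := eqVneq (S :\ z) set0.
    by rewrite Sz0 !value0 (cardsD1 z S) zS Sz0 cards0 /=; lra.
  have [|t tS pt] := anchored_top af _ Sz0; first by move=> u /setD1P[_ /Sk].
  have /setD1P[tz tS'] := tS.
  have at' : anchored p k.+1 (S :\ t).
    have := anchored_swap k.+1 (S :\ t :\ z) (etrans pt (esym pz)).
    rewrite setD1K ?inE 1?eq_sym ?tz // => <-.
    by rewrite setD1C setD1K.
  apply: le_trans (hi t tS' tz at').
  have zt := zmin t tS' pt.
  have := anchored_value_swap tS' zS (etrans pt (esym pz)) at'.
  by rewrite ger0_norm ?subr_ge0 //; lra.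
have [Sz0|Sz0] := eqVneq (S :\ z) set0.
  have := value_ge w zS; rewrite Sz0 => /(_ (anchored p k.+1)).
  rewrite !value0 (cardsD1 z S) zS Sz0 cards0 /= subr0 add0r; apply.
  by apply/anchoredP => u; rewrite inE.
have [f [fSz af ->]] := value_attained w (@anchored_playable _ p k) aSz Sz0.
have /setD1P[fz fS] := fSz.
have af' : anchored p k.+1 (S :\ f).
  rewrite setD1C in af; apply: anchored_raise af _ => //.
    by rewrite !inE eq_sym fz.
  by move=> u /setD1P[_ /Sk].
by have := value_ge w fS af'; rewrite step //; lra.
Qed.

(** A move of the rooted game is worth at least as much in the real game, for an
    even position.  If it is legal in the real game this is the comparison of the
    two games on the odd remainder.  Otherwise [f] is the centre of a star; with
    [x] a lightest leaf, the real game is worth at least [w f - w x] and the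
    remaining leaves at least [w x] to the opponent. *)
Lemma free_value_step S f r : linked p S -> ~~ odd #|S| -> f \in S ->
  anchored p r (S :\ f) ->
  (forall S', (#|S'| < #|S|)%N -> linked p S' -> anchored p r S' -> odd #|S'| ->
     free_value S' <= anchored_value r S') ->
  w f - anchored_value r (S :\ f) <= free_value S.
Proof.
move=> lS eS fS af IH.
have oSf : odd #|S :\ f| by rewrite odd_cardD1.
have [lf|nlf] := boolP (linked p (S :\ f)).
  have := IH _ (ltn_cardD1 fS) lf af oSf.
  by have := value_ge w fS lf; lra.
have [q sq] := unlinked_star lS fS (anchored_gapless af) nlf.
have fq := star_center sq; have [_ _ _ Fq] := sq.
have [x xF xmin] := exists_min w (odd_set0 oSf).
have := star_free_value Fq fq oSf xF xmin; rewrite setD1K //.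
by have := flat_anchored_value Fq af oSf xF xmin; lra.
Qed.

(** The two comparisons need each other: the odd case of the first uses
    the second on a smaller position, and the second uses the odd case of the
    first. *)
Lemma free_vs_anchored S : linked p S ->
  (forall r, anchored p r S -> if odd #|S|
     then free_value S <= anchored_value r S
     else anchored_value r S <= free_value S) /\
  (forall k, ~~ odd #|S| -> anchored p k.+1 S ->
     (forall u, u \in S -> p u <= k)%N ->
     0 <= free_value S + anchored_value k.+1 S).
Proof.
have [n] := ubnP #|S|; elim: n S => // n IHn S leSn lS.
have [->|S0] := eqVneq S set0.
  by split=> [r _|k _ _ _]; rewrite !value0 ?cards0 /= ?addr0 lexx.
have IHodd r S' : (#|S'| < #|S|)%N -> linked p S' -> anchored p r S' ->
    odd #|S'| -> free_value S' <= anchored_value r S'.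
  move=> leS' lS' aS' oS'; have [|+ _] := IHn S' _ lS'; first by lia.
  by move=> /(_ r aS'); rewrite oS'.
split=> [r aS|k eS aS Sk].
  case: ifPn => [oS|eS]; last first.
    have [f [fS af ->]] := value_attained w (@anchored_playable _ p r) aS S0.
    by apply: free_value_step => // S'; apply: IHodd.
  have [f [fS lf ->]] := value_attained w (@linked_playable _ p) lS S0.
  have [|IH1 IH2] := IHn (S :\ f) _ lf; first by have := ltn_cardD1 fS; lia.
  have eSf : ~~ odd #|S :\ f| by rewrite odd_cardD1 // oS.
  have [af|naf] := boolP (anchored p r (S :\ f)).
    have := IH1 r af; rewrite (negPf eSf).
    by have := value_ge w fS af; lra.
  (* [f] exhausts the last part, so in the rooted game it is collected at the
     very end, by the player to move since [S] is odd. *)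
  have [k [Er pf af Sk]] := unanchored_step lS aS fS lf naf.
  have := IH2 k eSf af Sk; rewrite Er in aS *.
  rewrite (@locked_value k.+1 S f) //; first by rewrite oS; lra.
  - move=> u uS; have [->|uf] := eqVneq u f; first by rewrite pf.
    by apply: leqW; apply: Sk; rewrite !inE uf.
  - move=> y yS py; have [->|yf] := eqVneq y f; first exact: lexx.
    by have := Sk y; rewrite !inE yf yS => /(_ isT); lia.
have [t tS pt] := anchored_top aS Sk S0.
have top0 : [set x in S | p x == k] != set0.
  by apply/set0Pn; exists t; rewrite inE tS pt eqxx.
have [a] := exists_max w top0; rewrite inE => /andP[aS' /eqP pa] amax.
have [z] := exists_min w top0; rewrite inE => /andP[zS /eqP pz] zmin.
rewrite (@locked_value k S z) //; last first.
  by move=> y yS py; apply: zmin; rewrite inE yS py eqxx.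
rewrite (negPf eS).
(* The first player claims [a] in the real game; the rooted game reserves [z]. *)
have aSa : anchored p k (S :\ a) by exact: anchored_lower.
have := free_value_step lS eS aS' aSa (IHodd k).
have := anchored_value_swap aS' zS (etrans pa (esym pz)) aSa.
have wza : w z <= w a by apply: zmin; rewrite inE aS' pa eqxx.
by rewrite ger0_norm ?subr_ge0 //; lra.
Qed.

(** Root the game just beyond the last part and add the two comparisons. *)
Lemma linked_value_ge0 S : linked p S -> ~~ odd #|S| -> 0 <= free_value S.
Proof.
move=> lS eS; have [->|S0] := eqVneq S set0; first by rewrite value0.
have [t tS tmax] := exists_highest p S0.
have aS : anchored p (p t).+1 S.
  apply/anchoredP=> u uS; split=> [|ut]; first exact/leqW/tmax.
  by case/andP: lS => /gaplessP gS _; apply: (gS u t).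
have [/(_ _ aS) + /(_ _ eS aS tmax)] := free_vs_anchored lS.
by rewrite (negPf eS); lra.
Qed.

End PathGame.

(** * From the value of the game to a strategy for Alice *)

Section Strategy.
Variables (R : realType) (G : sgraph) (w : G -> R).
Local Open Scope ring_scope.
Implicit Types (S : {set G}) (h q : seq G).

Local Notation game_value := (value w (@connected_on G)).

Definition remaining S q := foldl (fun (S : {set G}) v => S :\ v) S q.

Lemma legal_from_rcons S q v :
  legal_from S (rcons q v) = legal_from S q && claimable (remaining S q) v.
Proof. by elim: q S => [|a q IHq] S /=; rewrite ?andbT // IHq andbA. Qed.

Lemma card_remaining S q : legal_from S q -> (#|remaining S q| + size q = #|S|)%N.
Proof.
elim: q S => [|a q IHq] S /=; first by rewrite addn0.
by case/andP=> /andP[aS _] /IHq; rewrite addnS (cardsD1 a S) aS => ->.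
Qed.

Lemma connected_remaining S q :
  connected_on S -> legal_from S q -> connected_on (remaining S q).
Proof.
by elim: q S => [|a q IHq] S //= cS /andP[/andP[_ cSa]]; apply: IHq.
Qed.

Definition best_move S :=
  [pick v in S | connected_on (S :\ v) &&
                 (game_value S == w v - game_value (S :\ v))].

(** [x0] is a default for the histories at which no move is left. *)
Definition best_reply (x0 : G) h := odflt x0 (best_move (remaining [set: G] h)).

Hypothesis G_playable : playable (@connected_on G).

Lemma best_replyP x0 h (S := remaining [set: G] h) :
  connected_on S -> S != set0 ->
  [/\ best_reply x0 h \in S, connected_on (S :\ best_reply x0 h)
    & game_value S = w (best_reply x0 h) - game_value (S :\ best_reply x0 h)].
Proof.
move=> cS S0; rewrite /best_reply -/S /best_move; case: pickP => [v|nv] /=.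
  by case/and3P=> vS cv /eqP.
have [v [vS cv Ev]] := value_attained w G_playable cS S0.
by have := nv v; rewrite vS cv Ev eqxx.
Qed.

Lemma best_reply_guarantee x0 h q (S := remaining [set: G] h) :
  connected_on S -> legal_from S q -> size q = #|S| -> ~~ odd (size h) ->
  follows (best_reply x0) (h ++ q) ->
  \sum_(v in S) w v + game_value S <= 2 * \sum_(v <- alice_moves q) w v.
Proof.
have [n] := ubnP (size q); elim: n q h @S => // n IHn [|a q] h S /=.
  move=> _ _ _ /esym/eqP; rewrite cards_eq0 => /eqP-> _ _.
  by rewrite value0 !big_nil big_set0; lra.
move=> leqn cS /andP[/andP[aS ca] lq] sq eh fol.
have S0 : S != set0 by apply/set0Pn; exists a.
have Ea : a = best_reply x0 h by apply: fol => //; rewrite -cat_rcons prefix_prefix.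
have [_ _] := best_replyP x0 cS S0; rewrite -Ea -/S => ->.
rewrite (big_setD1 a) //=.
case: q leqn lq sq fol => [|b q] /= leqn lq sq fol.
  have /eqP : #|S :\ a| = 0%N by move: sq; rewrite (cardsD1 a S) aS => -[].
  rewrite cards_eq0 => /eqP->; rewrite value0 big_set0 big_seq1; lra.
case/andP: lq => /andP[bS cb] lq.
have := value_ge w bS cb.
rewrite (big_setD1 b) //= big_cons.
have Er : S :\ a :\ b = remaining [set: G] (h ++ [:: a; b]).
  by rewrite /remaining foldl_cat.
have := IHn q (h ++ [:: a; b]); rewrite -Er => /(_ _ cb lq).
rewrite -catA size_cat /= => IH.
have sq' : size q = #|S :\ a :\ b|.
  by move: sq; rewrite (cardsD1 a S) aS (cardsD1 b (S :\ a)) bS => -[].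
by have := IH _ sq' _ fol; rewrite addn2 /= negbK => /(_ ltac:(lia) eh); lra.
Qed.

Lemma alice_wins_of_value (x0 : G) : connected_on [set: G] ->
  0 <= game_value [set: G] -> alice_wins w.
Proof.
move=> cG vG; exists (best_reply x0) => [h lh sh eh|q /andP[lq /eqP sq] fol].
  have [||hS hc _] := @best_replyP x0 h; first exact: connected_remaining.
    have := card_remaining lh; rewrite cardsT => ch.
    by rewrite -card_gt0; lia.
  by rewrite /legal legal_from_rcons [legal_from _ _]lh /claimable hS hc.
have := @best_reply_guarantee x0 [::] q cG lq _ _ fol.
rewrite cardsT /= => /(_ sq isT).
rewrite (eq_bigl predT); last by move=> v; rewrite inE.
by lra.
Qed.

End Strategy.

(** * Connectedness in blow-ups of paths and cycles *)

Section PathPositions.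
Variables (G : sgraph) (p : G -> nat) (S : {set G}).
Hypothesis adj_p : forall x y, x \in S -> y \in S ->
  adj x y = (p y == (p x).+1) || (p x == (p y).+1).

Lemma connected_linked : connected_on S = linked p S.
Proof.
pose e : rel G := [rel u v | [&& u \in S, v \in S & adj u v]].
have e_sym : connect_sym e.
  by apply: sym_connect_sym => u v; rewrite /e /= adj_sym andbCA.
apply/idP/idP => [/forall_inP cS|/andP[/gaplessP gS /spreadP sS]].
  have conn x y : x \in S -> y \in S -> connect e x y.
    by move=> xS yS; have /forall_inP/(_ y yS) := cS x xS.
  apply/andP; split.
    apply/gaplessP=> x y xS yS xy; apply/occupiedP; apply: contraT => /occupiedP nz.
    have cl : closed e [pred z | p z <= p x].
      move=> u v /and3P[uS vS]; rewrite adj_p // !inE => uv.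
      have nx z : z \in S -> p z != (p x).+1.
        by move=> zS; apply: contra_notN nz => /eqP ?; exists z.
      have := nx u uS; have := nx v vS; lia.
    have := closed_connect cl (conn x y xS yS); rewrite !inE; lia.
  apply/spreadP=> x y xS yS xy; apply/exists_inP; apply: contraT.
  rewrite negb_exists_in => /forall_inP nS.
  have cl : closed e (pred1 x).
    move=> u v /and3P[uS vS]; rewrite adj_p //.
    by have := nS u uS; have := nS v vS; rewrite !negbK => /eqP-> /eqP->; lia.
  by have := closed_connect cl (conn x y xS yS); rewrite !inE eqxx eq_sym (negPf xy).
have up x y : x \in S -> y \in S -> p x < p y -> connect e x y.
  have [n] := ubnP (p y - p x); elim: n x => // n IHn x len xS yS xy.
  have [z zS Ez] := gS x y xS yS xy.
  have exz : e x z by rewrite /e /= xS zS adj_p // Ez eqxx.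
  have [Ey|nEy] := eqVneq (p y) (p x).+1.
    by apply: connect1; rewrite /e /= xS yS adj_p // Ey eqxx.
  by apply: connect_trans (connect1 exz) _; apply: IHn => //; lia.
have far x y : x \in S -> y \in S -> p x != p y -> connect e x y.
  by move=> xS yS; case: ltngtP => // xy _; [|rewrite e_sym]; apply: up.
apply/forall_inP=> x xS; apply/forall_inP=> y yS; rewrite -/e.
have [<-|xy] := eqVneq x y; first exact: connect0.
have [Exy|] := eqVneq (p x) (p y); last exact: far.
have [z zS zx] := sS x y xS yS xy.
by apply: (connect_trans (y := z)); apply: far; rewrite // -?Exy // eq_sym.
Qed.

End PathPositions.

Section CyclePositions.
Variables (n : nat) (k : 'I_n).

(** Positions along the path obtained from the cycle by removing [k]: its successor
    gets 0, its predecessor [n - 2], and [k] itself the unused value [n - 1]. *)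
Definition unroll (i : 'I_n) : nat := if k < i then i - k.+1 else i + n - k.+1.

Lemma unroll_adj i j : 1 < n -> i != k -> j != k ->
  cycle_adj i j = (unroll j == (unroll i).+1) || (unroll i == (unroll j).+1).
Proof.
move=> n1; rewrite /cycle_adj /= -!val_eqE /= /unroll => ik jk.
have S_mod (a : 'I_n) : (a.+1 %% n = if a.+1 == n then 0 else a.+1)%N.
  by case: eqVneq => [->|an]; rewrite ?modnn // modn_small //; have := ltn_ord a; lia.
rewrite !S_mod; have := ltn_ord i; have := ltn_ord j; have := ltn_ord k.
move=> kn jn i_n; case: (i.+1 =P n); case: (j.+1 =P n);
  by case: (k < i) / ltnP; case: (k < j) / ltnP; lia.
Qed.

Lemma unroll_onto m : m < n.-1 -> exists2 i : 'I_n, i != k & unroll i = m.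
Proof.
move=> mn; have kn := ltn_ord k.
have [mk|mk] := ltnP (m + k.+1) n.
  by exists (Ordinal mk); rewrite -?val_eqE /unroll /=; [|case: ifP]; lia.
have mk' : m + k.+1 - n < n by lia.
by exists (Ordinal mk'); rewrite -?val_eqE /unroll /=; [|case: ifP]; lia.
Qed.

Lemma unroll_max i : i != k -> unroll i < n.-1.
Proof.
rewrite -val_eqE /unroll /= => ik; have := ltn_ord i; have := ltn_ord k.
by case: ifP; lia.
Qed.

End CyclePositions.

(** * Blow-ups of cycles *)

Section CycleBlowup.
Variables (R : realDomainType) (n : nat) (G : sgraph) (part : G -> 'I_n).
Variable w : G -> R.
Hypotheses (n_ge3 : 2 < n) (part_adj : forall x y, adj x y = cycle_adj (part x) (part y)).
Implicit Types (S : {set G}).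

Definition misses S k := [forall x in S, part x != k].

Lemma misses_or_full S :
  (exists k, misses S k) \/ (forall k, ~~ misses S k).
Proof.
case: (boolP [exists k, misses S k]) => [/existsP|]; first by left.
by rewrite negb_exists => /forallP; right.
Qed.

Lemma misses_connected S k : misses S k ->
  connected_on S = linked (unroll k \o part) S.
Proof.
move=> /forall_inP Sk; apply: connected_linked => x y /Sk xk /Sk yk.
by rewrite part_adj (unroll_adj (ltnW n_ge3) xk yk).
Qed.

(** Without part [k] there is a blow-up of a path with all its [n - 1 >= 2] parts
    present; the vertices of part [k], if any, are adjacent to the part that
    follows [k]. *)
Lemma almost_full_connected S k :
  (forall i, i != k -> exists2 x, x \in S & part x = i) -> connected_on S.
Proof.
move=> Si; pose S' := [set x in S | part x != k].
have S'k : misses S' k by apply/forall_inP=> x; rewrite inE => /andP[].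
have onto m : m < n.-1 -> exists2 x, x \in S' & unroll k (part x) = m.
  case/(unroll_onto k) => i ik <-; have [x xS xi] := Si i ik.
  by exists x; rewrite ?inE ?xS xi.
have cS' : connected_on S'.
  rewrite (misses_connected S'k); apply/andP; split.
    apply/gaplessP=> u v uS vS /= uv; apply: onto.
    have := unroll_max (forall_inP S'k v vS); lia.
  apply/spreadP=> u v _ _ _ /=.
  have [E0|n0] := eqVneq (unroll k (part u)) 0.
    have [|x xS Ex] := onto 1; first by lia.
    by exists x; rewrite // Ex E0.
  have [|x xS Ex] := onto 0; first by lia.
  by exists x; rewrite // Ex eq_sym.
pose e : rel G := [rel u v | [&& u \in S, v \in S & adj u v]].
have e_sym : connect_sym e.
  by apply: sym_connect_sym => u v; rewrite /e /= adj_sym andbCA.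
have S'S x : x \in S' -> x \in S by rewrite inE => /andP[].
have conn x y : x \in S' -> y \in S' -> connect e x y.
  move=> xS yS; have /forall_inP/(_ y yS) := forall_inP cS' x xS.
  apply: connect_sub => u v /and3P[uS vS uv]; apply: connect1.
  by rewrite /e /= !S'S.
have reach x : x \in S -> exists2 y, y \in S' & connect e x y.
  move=> xS; have [xk|xk] := eqVneq (part x) k; last first.
    by exists x; rewrite ?inE ?xS ?connect0.
  have Sk : ordS k != k.
    rewrite -val_eqE /=; have := ltn_ord k.
    have [En|kn] := eqVneq k.+1 n; first by rewrite En modnn; lia.
    by move=> kn'; rewrite modn_small; lia.
  have [y yS yk] := Si _ Sk; exists y; first by rewrite inE yS yk.
  by apply: connect1; rewrite /e /= xS yS part_adj xk yk /cycle_adj /= eq_sym Sk eqxx.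
apply/forall_inP=> x xS; apply/forall_inP=> y yS.
have [x' x'S xx'] := reach x xS; have [y' y'S yy'] := reach y yS.
apply: connect_trans xx' (connect_trans (conn _ _ x'S y'S) _).
by rewrite e_sym.
Qed.

Lemma full_claimable S a : (forall k, ~~ misses S k) -> connected_on (S :\ a).
Proof.
move=> fS; apply: (@almost_full_connected _ (part a)) => i ia.
have := fS i; rewrite negb_forall_in => /exists_inP[x xS].
rewrite negbK => /eqP xi; exists x => //; rewrite !inE xS andbT.
by apply: contraNneq ia => <-; rewrite xi.
Qed.

Lemma cycle_blowup_playable : playable (@connected_on G).
Proof.
move=> S cS S0; have [[k Sk]|fS] := misses_or_full S.
- have sub v : misses (S :\ v) k.
    by apply/forall_inP=> x /setD1P[_ /(forall_inP Sk)].
  rewrite (misses_connected Sk) in cS.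
  have [v vS lv] := linked_playable cS S0; exists v => //.
  by rewrite (misses_connected (sub v)).
by case/set0Pn: S0 => v vS; exists v => //; apply: full_claimable.
Qed.

(** While every part is present, claiming a heaviest vertex leads by way of the
    opponent's reply to an even position, without loss in that round; the claim
    is legal since it exhausts at most one part.  Once a part is missing, the
    result on blow-ups of paths takes over. *)
Lemma cycle_blowup_value_ge0 S : connected_on S -> ~~ odd #|S| ->
  (0 <= value w (@connected_on G) S)%R.
Proof.
have [m] := ubnP #|S|; elim: m S => // m IHm S leSm cS eS.
have [->|S0] := eqVneq S set0; first by rewrite value0.
have [[k Sk]|fS] := misses_or_full S.
- have lS := cS; rewrite (misses_connected Sk) in lS.
  rewrite -(@eq_value _ _ w (linked (unroll k \o part))) //.
  + exact: linked_value_ge0.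
  + exact: linked_playable.
  + move=> S' /subsetP sS; rewrite (@misses_connected S' k) //.
    by apply/forall_inP=> x /sS /(forall_inP Sk).
have [a aS amax] := exists_max w S0.
have oSa : odd #|S :\ a| by rewrite odd_cardD1.
have ca := full_claimable a fS.
have [b [bS cb Eb]] := value_attained w cycle_blowup_playable ca (odd_set0 oSa).
have := value_ge w aS ca; rewrite Eb.
have /IHm := cb; rewrite odd_cardD1 // oSa => IH.
have := ltn_cardD1 aS; have := ltn_cardD1 bS => lb la.
have := IH ltac:(lia) isT.
have := amax b; case/setD1P: bS => _ bS /(_ bS).
by lra.
Qed.

End CycleBlowup.

Lemma blowup_parts (F G : sgraph) : is_blowup F G ->
  exists2 part : G -> F, forall x y, adj x y = adj (part x) (part y) &
    forall i, exists x, part x = i.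
Proof.
case=> V [V0 Vdis Vcov Vadj].
have /fin_all_exists[part partP] : forall x, exists i, x \in V i.
  by move=> x; have := in_setT x; rewrite -Vcov => /bigcupP[i _ xi]; exists i.
exists part => [x y|i]; first exact: Vadj.
have /set0Pn[x xi] := V0 i; exists x; apply: contraTeq xi => /Vdis Vd.
by have := disjointFr Vd (partP x) => ->.
Qed.

Theorem corollary3 (R : realType) (n : nat) (G : sgraph) (w : G -> R)
    (hn : 3 <= n) (hG : is_blowup (cycle_graph n) G) (hev : ~~ odd #|G|)
    (hw : forall v, (0 <= w v)%R) :
  alice_wins w.
Proof.
have [part part_adj part_onto] := blowup_parts hG.
have i0 : 'I_n by apply: (@Ordinal n 0); lia.
have [x0 _] := part_onto i0.
have cG : connected_on [set: G].
  apply: (@almost_full_connected n G part hn part_adj _ i0) => i _.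
  by have [x xi] := part_onto i; exists x; rewrite ?inE.
apply: (alice_wins_of_value (cycle_blowup_playable hn part_adj) x0 cG).
by apply: (cycle_blowup_value_ge0 w hn part_adj); rewrite ?cardsT.
Qed.
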